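(* Let $n\ge 1$ and let $f(x)=x^TAx+2a^Tx+a_0$ and $g(x)=x^TBx+2b^Tx+b_0$ be quadratic functions on $\mathbb{R}^n$ that are not affine, i.e. $A,B$ are nonzero real symmetric $n\times n$ matrices, $a,b\in\mathbb{R}^n$ and $a_0,b_0\in\mathbb{R}$. If the level set $\{g=0\}$ separates the level set $\{f=0\}$, then $\{f=0\}$ separates $\{g=0\}$ too.
   Context: For a function $p:\mathbb{R}^n\to\mathbb{R}$ write $\{p=0\}=\{x\in\mathbb{R}^n: p(x)=0\}$. For functions $p,q:\mathbb{R}^n\to\mathbb{R}$, the level set $\{q=0\}$ is said to separate $\{p=0\}$ if there are non-empty subsets $L^-,L^+$ of $\{p=0\}$ such that $\{p=0\}=L^-\cup L^+$ and $q(u)q(v)<0$ for all $u\in L^-$ and all $v\in L^+$. *)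

(* Defs.v *)
From HB Require Import structures.
From mathcomp Require Import all_boot all_order all_algebra.
From mathcomp Require Import classical_sets reals.

Set Implicit Arguments.
Unset Strict Implicit.
Unset Printing Implicit Defensive.

Import Order.TTheory GRing.Theory Num.Theory.

Local Open Scope classical_set_scope.
Local Open Scope ring_scope.

Definition quadratic (R : realType) (n : nat) (A : 'M[R]_n) (a : 'cV[R]_n)
    (a0 : R) (x : 'cV[R]_n) : R :=
  (x^T *m A *m x) 0 0 + 2 * (a^T *m x) 0 0 + a0.

Definition level_set0 (R : realType) (n : nat) (p : 'cV[R]_n -> R) :
    set 'cV[R]_n :=
  [set x | p x = 0].

(* [separates q p]: the level set of [q] separates that of [p]. The notion
   depends on the function [q] itself and not only on its level set. *)
Definition separates (R : realType) (n : nat) (q p : 'cV[R]_n -> R) : Prop :=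
  exists Lm Lp : set 'cV[R]_n,
    [/\ Lm !=set0, Lp !=set0, level_set0 p = Lm `|` Lp &
        forall u v : 'cV[R]_n, Lm u -> Lp v -> q u * q v < 0].

(* Main.v *)
Require Import Defs.
From mathcomp Require Import all_boot all_order all_algebra.
From mathcomp Require Import boolp classical_sets reals.
From mathcomp Require Import ring lra.

(** If [f] had constant sign, say [f > 0], on [{g = 0}], take [u], [v] on
    [{f = 0}] with [g u > 0 > g v]. On the line through [u] and [v], [g] has a
    root between them, so [f] is strictly concave there, hence negative outside
    the segment, where [g] therefore keeps the opposite signs of its two ends;
    this forces the leading coefficient of [g] on that line to vanish. The
    configuration is stable under small perturbations of the direction [v - u],
    so the quadratic form of [g] vanishes on an open set, i.e. [B = 0]. *)

Set Implicit Arguments.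
Unset Strict Implicit.

Import Order.TTheory GRing.Theory Num.Theory.

Local Open Scope ring_scope.

Lemma quad_ivt (R : rcfType) (c m k x y : R) :
  x <= y -> (c + m * x + k * x ^+ 2) * (c + m * y + k * y ^+ 2) <= 0 ->
  exists2 t, x <= t <= y & c + m * t + k * t ^+ 2 = 0.
Proof.
move=> xy gxy.
pose p : {poly R} := c%:P + m *: 'X + k *: 'X^2.
have pE t : p.[t] = c + m * t + k * t ^+ 2 by rewrite /p !hornerE.
have [gx|gx] := lerP (c + m * x + k * x ^+ 2) 0.
  (* A zero value at [x] leaves the sign at [y] undetermined, but [x] is then itself a root. *)
  have [gx0|gx0] := eqVneq (c + m * x + k * x ^+ 2) 0.
    by exists x; rewrite ?lexx.
  have gy : 0 <= c + m * y + k * y ^+ 2.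
    by rewrite -(@nmulr_rle0 _ (c + m * x + k * x ^+ 2)) // lt_neqAle gx0.
  have [|t xty /rootP pt] := @poly_ivt R p x y xy; first by rewrite !pE gx.
  by exists t; rewrite // -pE.
have gy : c + m * y + k * y ^+ 2 <= 0 by rewrite -(pmulr_rle0 _ gx).
have [|t xty /rootP pt] := @poly_ivt R (- p) x y xy.
  by rewrite !hornerN !pE oppr_le0 oppr_ge0 (ltW gx).
by exists t; rewrite // -pE; apply/oppr_inj; rewrite -hornerN pt oppr0.
Qed.

Lemma quad_pos_at_infty (R : realFieldType) (c m k x : R) : 0 < k ->
  exists2 t, `|x| <= t & 0 < c + m * t + k * t ^+ 2.
Proof.
move=> k0; pose M : R := `|c| + `|m|.
have M0 : 0 <= M / k by rewrite divr_ge0 ?addr_ge0 // ltW.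
(* As [1 <= t], [c + m * t] is at least [- M * t], while [k * t ^+ 2] is at least [(M + k) * t];
   this leaves at least [k * t]. *)
pose t : R := `|x| + 1 + M / k.
have t1 : 1 <= t by have := normr_ge0 x; rewrite /t; lra.
have t0 : 0 < t by exact: lt_le_trans t1.
exists t; first by rewrite /t -addrA lerDl addr_ge0.
have kt : M + k <= k * t.
  have -> : M + k = k * (1 + M / k) by field; rewrite gt_eqF.
  by rewrite ler_pM2l // /t lerD2r lerDr.
have ktt : (M + k) * t <= k * t ^+ 2 by rewrite expr2 mulrA ler_pM2r.
have mt : - (`|m| * t) <= m * t by rewrite -mulNr ler_pM2r ?lerNnormlW.
have ct : - (`|c| * t) <= c.
  by rewrite lerNl (le_trans (ler_norm _)) // normrN ler_peMr.
have kt0 : 0 < k * t by rewrite mulr_gt0.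
by move: ktt; rewrite /M; lra.
Qed.

Lemma quad_neg_near0 (R : realFieldType) (c m k : R) : c < 0 ->
  exists2 e, 0 < e & forall s, `|s| <= e -> c + m * s + k * s ^+ 2 < 0.
Proof.
move=> c0; pose M : R := `|m| + `|k|.
have M0 : 0 <= M by rewrite addr_ge0.
have D0 : 0 < M + 1 - c by lra.
(* This [e] is at most 1, so [m * s + k * s ^+ 2] is at most [M * e], which equals
   [- c - e * (1 - c)]. *)
exists (- c / (M + 1 - c)); first by rewrite divr_gt0 ?oppr_gt0.
set e := _ / _ => s se.
have e0 : 0 < e by rewrite divr_gt0 ?oppr_gt0.
have eD : e * (M + 1 - c) = - c by rewrite mulfVK // gt_eqF.
have e1 : e <= 1 by rewrite ler_pdivrMr //; lra.
have ms : m * s <= `|m| * e.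
  by rewrite (le_trans (ler_norm _)) // normrM ler_wpM2l.
have ss : `|s| ^+ 2 <= e.
  rewrite expr2 (le_trans (ler_pM _ _ se se)) //.
  by rewrite ler_piMr // ltW.
have ks : k * s ^+ 2 <= `|k| * e.
  by rewrite (le_trans (ler_norm _)) // normrM normrX ler_wpM2l.
have : 0 < e * (1 - c) by rewrite mulr_gt0 //; lra.
by move: eD; rewrite /M; lra.
Qed.

(* Stated at parameters [2] and [-1], just outside the segment [[0, 1]]. *)
Lemma quad_lead_eq0 (R : rcfType) (l q c m k : R) :
  (forall t, c + m * t + k * t ^+ 2 = 0 -> 0 < l * t + q * t ^+ 2) ->
  l * 2 + q * 2 ^+ 2 < 0 -> l * -1 + q * (-1) ^+ 2 < 0 ->
  c + m * 2 + k * 2 ^+ 2 < 0 -> 0 < c + m * -1 + k * (-1) ^+ 2 -> k = 0.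
Proof.
move=> fpos f2 f1 g2 g1.
(* Half of [f2] added to [f1] gives [3 * q < 0]. *)
have q0 : q < 0 by lra.
have fneg t : (2 <= t) || (t <= -1) -> l * t + q * t ^+ 2 < 0.
  have -> : l * t + q * t ^+ 2 = t * (l + q * t) by ring.
  case/orP=> ht.
    by rewrite pmulr_rlt0; [nra|lra].
  by rewrite nmulr_rlt0; [nra|lra].
(* A nonzero [k] fixes the sign of the second polynomial at both infinities: [k < 0] forces a root
   below -1, [k > 0] one above 2. There [fneg] contradicts [fpos]. *)
have [k0|k0|//] := ltgtP k 0.
- have Nk : 0 < - k by lra.
  have [t ht gt0] := @quad_pos_at_infty R (- c) m (- k) 1 Nk.
  rewrite normr1 in ht.
  have [| |r /andP[_ hr] /fpos] := @quad_ivt R c m k (- t) (-1); first lra.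
    by rewrite nmulr_rle0 ?ltW //; lra.
  by rewrite ltNge ltW // fneg // hr orbT.
- have [t ht gt0] := @quad_pos_at_infty R c m k 2 k0.
  rewrite ger0_norm // in ht.
  have [//| |r /andP[hr _] /fpos] := @quad_ivt R c m k 2 t.
    by rewrite nmulr_rle0 // ltW.
  by rewrite ltNge ltW // fneg // hr.
Qed.

(** Only the coefficient of [t ^+ 2] is needed explicitly, so the linear one stays existential. *)
Lemma quadratic_line {R : realType} {n : nat} (A : 'M[R]_n) (a : 'cV[R]_n)
    (a0 : R) (x d : 'cV[R]_n) :
  exists l, forall t, quadratic A a a0 (x + t *: d) =
    quadratic A a a0 x + l * t + (d^T *m A *m d) 0 0 * t ^+ 2.
Proof.
exists ((x^T *m A *m d) 0 0 + (d^T *m A *m x) 0 0 + 2 * (a^T *m d) 0 0) => t.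
rewrite /quadratic !linearD !linearZ /= !mulmxDl -!scalemxAl !linearD !linearZ /= !mxE.
by ring.
Qed.

Lemma quadraticN {R : realType} {n : nat} (A : 'M[R]_n) (a : 'cV[R]_n)
    (a0 : R) (x : 'cV[R]_n) :
  quadratic (- A) (- a) (- a0) x = - quadratic A a a0 x.
Proof.
by rewrite /quadratic !linearN /= !mulNmx !mxE; ring.
Qed.

Lemma quadratic_neg_near {R : realType} {n : nat} (A : 'M[R]_n) (a : 'cV[R]_n)
    (a0 : R) (x d : 'cV[R]_n) : quadratic A a a0 x < 0 ->
  exists2 e, 0 < e & forall s, `|s| <= e -> quadratic A a a0 (x + s *: d) < 0.
Proof.
move=> x0; have [l lE] := quadratic_line A a a0 x d.
have [e e0 he] := @quad_neg_near0 R _ l ((d^T *m A *m d) 0 0) x0.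
by exists e => // s /he; rewrite lE.
Qed.

(** Polarization: on a sum of two basis vectors the form reduces to [B i j + B j i], that is, twice
    [B i j]. *)
Lemma sym_form_eq0 (R : numFieldType) (n : nat) (B : 'M[R]_n) : B^T = B ->
  (forall e : 'cV[R]_n, (e^T *m B *m e) 0 0 = 0) -> B = 0.
Proof.
move=> Bsym B0; apply/matrixP => i j; rewrite mxE.
pose E (i j : 'I_n) := (delta_mx i 0 : 'cV[R]_n)^T *m B *m (delta_mx j 0 : 'cV[R]_n).
have EE k l : E k l 0 0 = B k l.
  by rewrite /E trmx_delta -rowE -colE !mxE.
have := B0 (delta_mx i 0 + delta_mx j 0).
rewrite [(_ + _)^T]linearD /= !mulmxDl !mulmxDr.
have -> : forall M1 M2 M3 M4 : 'M[R]_1, (M1 + M2 + (M3 + M4)) 0 0 =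
  M1 0 0 + M2 0 0 + (M3 0 0 + M4 0 0) by move=> *; rewrite !mxE.
rewrite !B0 -/(E i j) -/(E j i) !EE add0r addr0.
have -> : B j i = B i j by rewrite -[in LHS]Bsym mxE.
by move/eqP; rewrite -mulr2n mulrn_eq0 => /eqP.
Qed.

Lemma quadratic_level_sign (R : realType) (n : nat) (A B : 'M[R]_n)
    (a b : 'cV[R]_n) (a0 b0 : R) (u v : 'cV[R]_n) :
  B^T = B ->
  quadratic A a a0 u = 0 -> quadratic A a a0 v = 0 ->
  0 < quadratic B b b0 u -> quadratic B b b0 v < 0 ->
  (forall x, quadratic B b b0 x = 0 -> 0 < quadratic A a a0 x) -> B = 0.
Proof.
set f := quadratic A a a0; set g := quadratic B b b0.
move=> Bsym fu fv gu gv fpos.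
pose w := v - u.
have uw1 : u + 1 *: w = v by rewrite scale1r /w addrC subrK.
pose qB (d : 'cV[R]_n) := (d^T *m B *m d) 0 0.
(* The four hypotheses are strict, hence open in [d], and do not ask that [f] vanish at [u + d]; so
   they survive perturbing [w]. *)
have key d : f (u + 2 *: d) < 0 -> f (u + -1 *: d) < 0 ->
    g (u + 2 *: d) < 0 -> 0 < g (u + -1 *: d) -> qB d = 0.
  have [l lE] := quadratic_line A a a0 u d.
  have [m mE] := quadratic_line B b b0 u d.
  rewrite /f /g !lE !mE -/f fu !add0r.
  apply: quad_lead_eq0 => t; rewrite -mE => /fpos.
  by rewrite /f lE -/f fu add0r.
have [l lE] := quadratic_line A a a0 u w.
have [m mE] := quadratic_line B b b0 u w.
rewrite -/f -/g in lE mE; set q := (_ *m _) 0 0 in lE; set k := (_ *m _) 0 0 in mE.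
have lq : l = - q.
  by have := lE 1; rewrite uw1 fu fv add0r mulr1 expr1n mulr1; lra.
have fE t : f (u + t *: w) = q * (t * (t - 1)) by rewrite lE fu lq; ring.
(* A weak sign change of [g] on the line yields a root, where [f] is positive. On [[0, 1]] this
   forces [q < 0]; on [[1, 2]] and [[-1, 0]] it is then impossible. *)
have gsame x y : x <= y -> g (u + x *: w) * g (u + y *: w) <= 0 ->
    exists2 t, x <= t <= y & 0 < q * (t * (t - 1)).
  rewrite !mE => xy /(quad_ivt xy)[t xty]; rewrite -mE => /fpos.
  by rewrite fE; exists t.
have g0E : g (u + 0 *: w) = g u by rewrite scale0r addr0.
have q0 : q < 0.
  have [//||t /andP[t0 t1] ht] := gsame 0 1.
    by rewrite g0E uw1 pmulr_rle0 // ltW.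
  have : t * (t - 1) <= 0 by nra.
  by nra.
have f2 : f (u + 2 *: w) < 0 by rewrite fE; lra.
have f1 : f (u + -1 *: w) < 0 by rewrite fE; lra.
have g2 : g (u + 2 *: w) < 0.
  rewrite ltNge; apply/negP => g2.
  have [||t /andP[t0 t1] ht] := gsame 1 2; first lra.
    by rewrite uw1 nmulr_rle0.
  have : 0 <= t * (t - 1) by nra.
  by nra.
have g1 : 0 < g (u + -1 *: w).
  rewrite ltNge; apply/negP => g1.
  have [||t /andP[t0 t1] ht] := gsame (-1) 0; first lra.
    by rewrite g0E pmulr_lle0.
  have : 0 <= t * (t - 1) by nra.
  by nra.
have qBw : qB w = 0 by exact: key.
apply: sym_form_eq0 => // e; rewrite -/(qB e).
have shift c s : u + c *: (w + s *: e) = u + c *: w + s *: (c *: e).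
  by rewrite scalerDr addrA !scalerA mulrC.
have [e1 e1_gt0 he1] := quadratic_neg_near (2 *: e) f2.
have [e2 e2_gt0 he2] := quadratic_neg_near (-1 *: e) f1.
have [e3 e3_gt0 he3] := quadratic_neg_near (2 *: e) g2.
have g1N : quadratic (- B) (- b) (- b0) (u + -1 *: w) < 0.
  by rewrite quadraticN oppr_lt0.
have [e4 e4_gt0 he4] := quadratic_neg_near (-1 *: e) g1N.
pose h := Num.min (Num.min e1 e2) (Num.min e3 e4).
have h0 : 0 < h by rewrite !lt_min e1_gt0 e2_gt0 e3_gt0.
have qB0 s : `|s| = h -> qB (w + s *: e) = 0.
  move=> sh; apply: key; rewrite shift.
  - by apply: he1; rewrite sh !ge_min lexx.
  - by apply: he2; rewrite sh !ge_min lexx orbT.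
  - by apply: he3; rewrite sh !ge_min lexx orbT.
  - rewrite -oppr_lt0 -quadraticN.
    by apply: he4; rewrite sh !ge_min lexx !orbT.
have qBE s : qB (w + s *: e) =
    ((w^T *m B *m e) 0 0 + (e^T *m B *m w) 0 0) * s + qB e * s ^+ 2.
  rewrite -[RHS]add0r -qBw /qB [(w + _)^T]linearD /= [(s *: e)^T]linearZ /= !mulmxDl !mulmxDr.
  by rewrite -!scalemxAl -!scalemxAr !mxE; ring.
(* Adding the equations at [h] and [- h] cancels the linear term and isolates [qB e]. *)
have := qB0 h (gtr0_norm h0); rewrite qBE => hp.
have := qB0 (- h); rewrite normrN qBE => /(_ (gtr0_norm h0)) hn.
have : qB e * h ^+ 2 = 0 by move: hp hn; rewrite sqrrN mulrN; lra.
by move/eqP; rewrite mulf_eq0 expf_eq0 /= (gt_eqF h0) orbF => /eqP.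
Qed.

(** Negative cross products force [q] to be nonzero with opposite constant signs on the two parts;
    which part is negative is left open by the definition, hence the case split. *)
Lemma separatesP (R : realType) (n : nat) (q p : 'cV[R]_n -> R) :
  separates q p <->
  [/\ exists2 u, p u = 0 & q u < 0, exists2 v, p v = 0 & 0 < q v &
      forall x, p x = 0 -> q x <> 0].
Proof.
split=> [[Lm [Lp [[u Lu] [v Lv] pE qlt]]]|[[u pu qu] [v pv qv] q0]].
  have inp x : Lm x \/ Lp x -> p x = 0.
    by move=> Lx; have : level_set0 p x by rewrite pE.
  have pu := inp u (or_introl Lu); have pv := inp v (or_intror Lv).
  have quv := qlt _ _ Lu Lv.
  have q0 x : p x = 0 -> q x <> 0.
    move=> px qx; have : level_set0 p x by [].
    rewrite pE => -[Lx|Lx].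
      by have := qlt _ _ Lx Lv; rewrite qx mul0r ltxx.
    by have := qlt _ _ Lu Lx; rewrite qx mulr0 ltxx.
  have [qu|qu|/(q0 u pu)//] := ltgtP (q u) 0.
    by split=> //; [exists u|exists v => //; rewrite -(nmulr_rlt0 _ qu)].
  by split=> //; [exists v => //; rewrite -(pmulr_rlt0 _ qu)|exists u].
exists [set x | p x = 0 /\ q x < 0]%classic, [set x | p x = 0 /\ 0 < q x]%classic.
split; [by exists u|by exists v| |].
  apply/seteqP; split => [x px|x [[]|[]]//].
  by have [qx|qx|/(q0 x px)//] := ltgtP (q x) 0; [left|right].
by move=> x y [_ qx] [_ qy]; rewrite nmulr_rlt0.
Qed.

Theorem theorem2p7 (R : realType) (n : nat) (n_ge1 : (1 <= n)%N)
    (A B : 'M[R]_n) (a b : 'cV[R]_n) (a0 b0 : R)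
    (A_sym : A^T = A) (B_sym : B^T = B) (A_neq0 : A <> 0) (B_neq0 : B <> 0) :
  separates (quadratic B b b0) (quadratic A a a0) ->
  separates (quadratic A a a0) (quadratic B b b0).
Proof.
move=> /separatesP[[v fv gv] [u fu gu] disj].
have fneq0 x : quadratic B b b0 x = 0 -> quadratic A a a0 x <> 0.
  by move=> gx fx; exact: disj gx.
(* If one sign of [f] is missing on [{g = 0}], then [f], having no zero there, has constant sign.
   The negative case is reduced to the positive one by passing to [- f]. *)
apply/separatesP; split=> //; apply: contrapT => nex; apply: B_neq0.
- apply: (quadratic_level_sign B_sym fu fv gu gv) => x gx.
  have [fx|//|/(fneq0 x gx)//] := ltgtP (quadratic A a a0 x) 0.
  by case: nex; exists x.
- apply: (@quadratic_level_sign _ _ (- A) _ (- a) b (- a0) b0 u v B_sym) => //;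
    rewrite ?quadraticN ?fu ?fv ?oppr0 // => x gx.
  rewrite quadraticN oppr_gt0.
  have [//|fx|/(fneq0 x gx)//] := ltgtP (quadratic A a a0 x) 0.
  by case: nex; exists x.
Qed.
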